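(* Let $\mathbf{x}^\star\in\mathbb{X}$ be a fixed point, i.e. $\mathbf{G}^T(\mathbf{x}^\star)\mathbf{g}(\mathbf{x}^\star)=\mathbf{0}$, and put $\epsilon_{\min}=\|\mathbf{g}(\mathbf{x}^\star)\|$. Let the step-size $\alpha$ satisfy $$\max\left\{1-\frac{3\sigma_{\min}}{\sigma_{\max}},0\right\}<\alpha\leq 1,$$ and suppose $$\omega\epsilon_{\min}<\frac{\sigma_{\min}^2}{\sqrt{2}\,\alpha}\left[3-(1-\alpha)\frac{\sigma_{\max}}{\sigma_{\min}}\right].$$ Define $$T_1=\frac{\alpha\omega}{2\sigma_{\min}},\qquad T_2=(1-\alpha)\frac{\sigma_{\max}}{\sigma_{\min}}+\frac{\sqrt{2}\,\alpha\,\omega\,\epsilon_{\min}}{\sigma_{\min}^2}.$$ Let $\kappa$ satisfy $0<\kappa<\dfrac{(1-T_2)^2}{4\alpha T_1}$ and define $$\rho_{\min}=\frac{(1-T_2)-\sqrt{(1-T_2)^2-4\alpha T_1\kappa}}{2T_1},\qquad \rho_{\max}=\frac{(1-T_2)+\sqrt{(1-T_2)^2-4\alpha T_1\kappa}}{2T_1}.$$ Suppose that the iterates of the Gossip-based Gauss-Newton algorithm satisfy $\|\mathbf{d}_i^k(\ell_k)-\mathbf{d}_i^k\|\leq\kappa$ for all $k\ge 0$ and all agents $i\in\{1,\dots,I\}$, and that the initial points satisfy $\|\mathbf{x}_i^0-\mathbf{x}^\star\|<\rho_{\max}$ for every $i$. Then for every agent $i$ $$\limsup_{k\to\infty}\|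\mathbf{x}_i^{k+1}-\mathbf{x}^\star\|\leq\rho_{\min}.$$
   Context: Norms of vectors are Euclidean and norms of matrices are spectral norms. Problem data. $\mathbb{X}\subset\mathbb{R}^N$ is a compact convex set and $P_{\mathbb{X}}$ is the Euclidean projection onto $\mathbb{X}$. $\mathbf{g}:\mathbb{R}^N\to\mathbb{R}^M$ is continuously differentiable with $M\times N$ Jacobian $\mathbf{G}(\mathbf{x})=\partial\mathbf{g}(\mathbf{x})/\partial\mathbf{x}^T$, and is split among $I$ agents as $\mathbf{g}=[\mathbf{g}_1^T,\dots,\mathbf{g}_I^T]^T$, $\mathbf{g}_i:\mathbb{R}^N\to\mathbb{R}^{M_i}$, $\sum_iM_i=M$, with $\mathbf{G}_i(\mathbf{x})=\partial\mathbf{g}_i(\mathbf{x})/\partial\mathbf{x}^T$. Assumptions on the data. (1) $\|\mathbf{g}(\mathbf{x})\|\le\epsilon_{\max}$ for $\mathbf{x}\in\mathbb{X}$. (2) $\mathbf{G}(\mathbf{x})$ has full column rank for all $\mathbf{x}\in\mathbb{X}$, and with $\sigma_{\min}=\min_{\mathbf{x}\in\mathbb{X}}\sqrt{\lambda_{\min}(\mathbf{G}^T(\mathbf{x})\mathbf{G}(\mathbf{x}))}$ and $\sigma_{\max}=\max_{\mathbf{x}\in\mathbb{X}}\sqrt{\lambda_{\max}(\mathbf{G}^T(\mathbf{x})\mathbf{G}(\mathbf{x}))}$ one has $0<\sigma_{\min}\le\sigma_{\max}<\infty$. (3) $\|\mathbf{G}(\mathbf{x})-\mathbf{G}(\mathbf{x}')\|\le\omega\|\mathbf{x}-\mathbf{x}'\|$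 for all $\mathbf{x},\mathbf{x}'\in\mathbb{X}$, with $\omega>0$. Gossip-based Gauss-Newton (GGN) algorithm with constant step-size $\alpha\in(0,1]$. Each agent $i$ holds an iterate $\mathbf{x}_i^k\in\mathbb{X}$, $k=0,1,2,\dots$, starting from $\mathbf{x}_i^0\in\mathbb{X}$. For update $k$, agent $i$ sets $\mathbf{h}_{k,i}(0)=\mathbf{G}_i^T(\mathbf{x}_i^k)\mathbf{g}_i(\mathbf{x}_i^k)\in\mathbb{R}^N$ and $\mathbf{H}_{k,i}(0)=\mathbf{G}_i^T(\mathbf{x}_i^k)\mathbf{G}_i(\mathbf{x}_i^k)\in\mathbb{R}^{N\times N}$. Then $\ell_k$ gossip exchanges with real $I\times I$ weight matrices $\mathbf{W}_k(\ell)=[W^k_{ij}(\ell)]$ are performed: for $1\le\ell\le\ell_k$, $\mathbf{h}_{k,i}(\ell)=\sum_jW^k_{ij}(\ell)\mathbf{h}_{k,j}(\ell-1)$ and $\mathbf{H}_{k,i}(\ell)=\sum_jW^k_{ij}(\ell)\mathbf{H}_{k,j}(\ell-1)$. The approximated descent is $\mathbf{d}_i^k(\ell_k)=\mathbf{H}_{k,i}^{-1}(\ell_k)\mathbf{h}_{k,i}(\ell_k)$ (the matrices $\mathbf{H}_{k,i}(\ell_k)$ being invertible so that the algorithm is well defined), and the update is $\mathbf{x}_i^{k+1}=P_{\mathbb{X}}[\mathbf{x}_i^k-\alpha\mathbf{d}_i^k(\ell_k)]$. The exact descent at agent $i$ is $\mathbf{d}_i^k=[\mathbf{G}^T(\mathbf{x}_i^k)\mathbf{G}(\mathbf{x}_i^k)]^{-1}\mathbf{G}^T(\mathbf{x}_i^k)\mathbf{g}(\mathbf{x}_i^k)$.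 *)

(* Defs.v *)
From mathcomp Require Import all_boot all_order all_algebra.
From mathcomp Require Import all_classical all_reals all_analysis.

Set Implicit Arguments.
Unset Strict Implicit.
Unset Printing Implicit Defensive.

Import Order.TTheory GRing.Theory Num.Theory.
Import numFieldNormedType.Exports.

Local Open Scope classical_set_scope.
Local Open Scope ring_scope.

(* Vectors are columns.  The library norm `|x| on matrices is the max norm; it
   is used only through the topology (compactness, differentiability,
   continuity), which in finite dimension is the Euclidean one. *)

Section Euclidean.
Context {R : realType}.

Definition enorm n (v : 'cV[R]_n) : R := Num.sqrt (\sum_(i < n) v i 0 ^+ 2).

(* For symmetric A (and n > 0) the set of real eigenvalues is finite and
   nonempty, so that inf and sup are its minimum and maximum. *)
Definition lambda_min n (A : 'M[R]_n) : R := inf [set a | eigenvalue A a].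
Definition lambda_max n (A : 'M[R]_n) : R := sup [set a | eigenvalue A a].

Definition spectral_norm m n (A : 'M[R]_(m, n)) : R :=
  Num.sqrt (lambda_max (A^T *m A)).

Definition is_minimum (S : set R) (a : R) : Prop := S a /\ lbound S a.
Definition is_maximum (S : set R) (a : R) : Prop := S a /\ ubound S a.

(* [get] picks an arbitrary element; on a nonempty compact convex set the
   minimizer exists and is unique. *)
Definition proj n (X : set 'cV[R]_n) (y : 'cV[R]_n) : 'cV[R]_n :=
  get [set p | X p /\ forall z, X z -> enorm (y - p) <= enorm (y - z)].

(* dg/dx^T, of size m x n; the library's [jacobian] is for row vectors and is
   the transpose of this one. *)
Definition Jac n m (g : 'cV[R]_n -> 'cV[R]_m) (x : 'cV[R]_n) : 'M[R]_(m, n) :=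
  \matrix_(i, j) 'D_(delta_mx j 0) (fun y => g y i 0) x.

Definition continuously_differentiable n m (g : 'cV[R]_n -> 'cV[R]_m) : Prop :=
  (forall x, differentiable g x) /\ continuous (Jac g).

End Euclidean.

Section GossipGaussNewton.
Context {R : realType} {N I : nat} {M : 'I_I -> nat}.

(* Agents are indexed by 'I_I and g = [g_1; ...; g_I] has blocks of sizes M i. *)
Variable g : 'cV[R]_N -> 'cV[R]_(\sum_(i < I) M i).

Definition agent_fun (i : 'I_I) (x : 'cV[R]_N) : 'cV[R]_(M i) :=
  submxcol (g x) i.

Definition exact_descent (x : 'cV[R]_N) : 'cV[R]_N :=
  invmx ((Jac g x)^T *m Jac g x) *m ((Jac g x)^T *m g x).

(* The exchange number l >= 1 uses the weights W l; W 0 is never used. *)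
Fixpoint gossip (V : lmodType R) (W : nat -> 'M[R]_I) (v0 : 'I_I -> V)
    (l : nat) : 'I_I -> V :=
  if l is l'.+1 then fun i => \sum_(j < I) W l i j *: gossip W v0 l' j else v0.

Definition local_h (z : 'I_I -> 'cV[R]_N) (i : 'I_I) : 'cV[R]_N :=
  (Jac (agent_fun i) (z i))^T *m agent_fun i (z i).

Definition local_H (z : 'I_I -> 'cV[R]_N) (i : 'I_I) : 'M[R]_N :=
  (Jac (agent_fun i) (z i))^T *m Jac (agent_fun i) (z i).

Definition gossip_descent (W : nat -> 'M[R]_I) (l : nat)
    (z : 'I_I -> 'cV[R]_N) (i : 'I_I) : 'cV[R]_N :=
  invmx (gossip W (local_H z) l i) *m gossip W (local_h z) l i.

(* x k i is the iterate of agent i before update k, ell k the number of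
   exchanges and W k l the weights of exchange l in update k. *)
Definition GGN_iterates (X : set 'cV[R]_N) (alpha : R) (ell : nat -> nat)
    (W : nat -> nat -> 'M[R]_I) (x : nat -> 'I_I -> 'cV[R]_N) : Prop :=
  [/\ forall i, X (x 0%N i),
      forall k i, gossip (W k) (local_H (x k)) (ell k) i \in unitmx &
      forall k i, x k.+1 i =
        proj X (x k i - alpha *: gossip_descent (W k) (ell k) (x k) i)].

End GossipGaussNewton.

(* Main.v *)
Require Import Defs.
From mathcomp Require Import all_boot all_order all_algebra.
From mathcomp Require Import all_classical all_reals all_analysis.
From mathcomp Require Import ring lra.

Set Implicit Arguments.
Unset Strict Implicit.
Unset Printing Implicit Defensive.

Import Order.TTheory GRing.Theory Num.Theory.
Import numFieldNormedType.Exports.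

Local Open Scope classical_set_scope.
Local Open Scope ring_scope.

(** The error e k = |x_i^k - xs| of agent i satisfies the scalar recursion
      e (k+1) <= T1 (e k)^2 + T2 (e k) + alpha kappa,
    and rho_min < rho_max are the fixed points of the quadratic map on the
    right.  This map is increasing on nonnegative reals, and it contracts
    [rho_min, r] towards rho_min for every r < rho_max, so that a sequence
    started below rho_max has limsup at most rho_min
    ([quadratic_recursion_limn_esup_le]).

    The recursion has three ingredients.  The projection onto X does not
    increase the distance to a point of X ([proj_spec]).  Replacing the exact
    descent by the gossip one costs at most alpha kappa.  An exact Gauss-Newton
    step leaves an error with a quadratic part, coming from the Taylor remainder
    of g, and a linear part proportional to |g xs|, coming from the variation of
    the Jacobian between x and xs ([gauss_newton_error_le]).  The coupling
    between agents enters only through the bound kappa, so each agent is treated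
    separately.

    The hypotheses speak of eigenvalues, through sigma_min and spectral norms,
    while the estimates need bounds on |A v|; the link is the variational
    characterization of the extreme eigenvalues of a symmetric matrix
    ([le_lambda_max], [ge_lambda_min]). *)

(** * Euclidean geometry and projections *)

Section EuclideanSpace.
Context {R : realType}.

Definition dot n (u v : 'cV[R]_n) : R := \sum_(i < n) u i 0 * v i 0.

Lemma dotE n (u v : 'cV[R]_n) : dot u v = (u^T *m v) 0 0.
Proof. by rewrite mxE; apply: eq_bigr => i _; rewrite mxE. Qed.

Lemma dotC n (u v : 'cV[R]_n) : dot u v = dot v u.
Proof. by apply: eq_bigr => i _; rewrite mulrC. Qed.

Lemma dotDr n (u v w : 'cV[R]_n) : dot u (v + w) = dot u v + dot u w.
Proof. by rewrite !dotE mulmxDr mxE. Qed.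

Lemma dotZr n a (u v : 'cV[R]_n) : dot u (a *: v) = a * dot u v.
Proof. by rewrite !dotE -scalemxAr mxE. Qed.

Lemma dotNr n (u v : 'cV[R]_n) : dot u (- v) = - dot u v.
Proof. by rewrite !dotE mulmxN mxE. Qed.

Lemma dotDl n (u v w : 'cV[R]_n) : dot (v + w) u = dot v u + dot w u.
Proof. by rewrite dotC dotDr !(dotC u). Qed.

Lemma dotZl n a (u v : 'cV[R]_n) : dot (a *: v) u = a * dot v u.
Proof. by rewrite dotC dotZr dotC. Qed.

Lemma dotNl n (u v : 'cV[R]_n) : dot (- v) u = - dot v u.
Proof. by rewrite dotC dotNr dotC. Qed.

Definition dot_linear := (dotDr, dotDl, dotZr, dotZl, dotNr, dotNl).

Lemma dot_mulmx m n (A : 'M[R]_(m, n)) u v : dot (A *m u) v = dot u (A^T *m v).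
Proof. by rewrite !dotE trmx_mul mulmxA. Qed.

Lemma dot_ge0 n (u : 'cV[R]_n) : 0 <= dot u u.
Proof. by apply: sumr_ge0 => i _; rewrite -expr2 sqr_ge0. Qed.

Lemma dot_eq0 n (u : 'cV[R]_n) : dot u u = 0 -> u = 0.
Proof.
move=> /psumr_eq0P u0; apply/matrixP => i j; rewrite ord1 mxE.
have /eqP := u0 (fun i _ => ltac:(rewrite -expr2; exact: sqr_ge0)) i isT.
by rewrite mulf_eq0 orbb => /eqP.
Qed.

Lemma enormE n (u : 'cV[R]_n) : enorm u = Num.sqrt (dot u u).
Proof. by congr Num.sqrt; apply: eq_bigr => i _; rewrite expr2. Qed.

Lemma enorm_ge0 n (u : 'cV[R]_n) : 0 <= enorm u.
Proof. exact: sqrtr_ge0. Qed.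

Lemma sqr_enorm n (u : 'cV[R]_n) : enorm u ^+ 2 = dot u u.
Proof. by rewrite enormE sqr_sqrtr ?dot_ge0. Qed.

Lemma le_enorm m n (u : 'cV[R]_m) (v : 'cV[R]_n) :
  (enorm u <= enorm v) = (dot u u <= dot v v).
Proof. by rewrite !enormE ler_sqrt ?dot_ge0. Qed.

Lemma enorm_eq0 n (u : 'cV[R]_n) : enorm u = 0 -> u = 0.
Proof. by move=> u0; apply: dot_eq0; rewrite -sqr_enorm u0 expr0n. Qed.

Lemma enormZ n a (u : 'cV[R]_n) : enorm (a *: u) = `|a| * enorm u.
Proof.
by rewrite !enormE !dot_linear mulrA -expr2 sqrtrM ?sqr_ge0// sqrtr_sqr.
Qed.

Lemma enorm0 n : enorm (0 : 'cV[R]_n) = 0.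
Proof. by rewrite -(scale0r 0) enormZ normr0 mul0r. Qed.

Lemma enormN n (u : 'cV[R]_n) : enorm (- u) = enorm u.
Proof. by rewrite -scaleN1r enormZ normrN1 mul1r. Qed.

(** Cauchy-Schwarz: the square of the norm of |v|^2 u - <u, v> v is
    nonnegative. *)
Lemma dot_le n (u v : 'cV[R]_n) : dot u v <= enorm u * enorm v.
Proof.
have [v0|v_neq0] := eqVneq (dot v v) 0.
  by rewrite (dot_eq0 v0) -(scale0r v) dotZr enormZ normr0 !mul0r mulr0.
have vv_gt0 : 0 < dot v v by rewrite lt_def v_neq0 dot_ge0.
have : 0 <= dot (dot v v *: u - dot u v *: v) (dot v v *: u - dot u v *: v).
  exact: dot_ge0.
rewrite !dot_linear (dotC v u) => ge0.
have {}ge0 : 0 <= dot v v * (dot u u * dot v v - dot u v ^+ 2) by nra.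
rewrite pmulr_rge0// subr_ge0 in ge0.
apply: le_trans (ler_norm _) _.
by rewrite -sqrtr_sqr !enormE -sqrtrM ?dot_ge0// ler_wsqrtr.
Qed.

Lemma enormD n (u v : 'cV[R]_n) : enorm (u + v) <= enorm u + enorm v.
Proof.
rewrite -(@ler_pXn2r _ 2)// ?nnegrE ?addr_ge0 ?enorm_ge0//.
rewrite sqrrD !sqr_enorm !dot_linear (dotC v u).
by have := dot_le u v; lra.
Qed.

Lemma mul_le_cancel (a b : R) : 0 <= a -> 0 <= b -> a ^+ 2 <= a * b -> a <= b.
Proof.
move=> a_ge0 b_ge0; have [->//|a_neq0] := eqVneq a 0.
by rewrite expr2 ler_pM2l// lt_def a_neq0.
Qed.

(** At t small compared with a / |b| a positive linear term would dominate.  This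
    turns an optimum into a first-order condition, both for the projection and
    for the quadratic form of a symmetric matrix. *)
Lemma first_order_le0 (a b : R) :
  (forall t, 0 < t -> t <= 1 -> 2 * t * a <= t ^+ 2 * b) -> a <= 0.
Proof.
move=> quad; rewrite leNgt; apply/negP => a_gt0.
have c_gt0 : 0 < a + `|b| by rewrite ltr_wpDr.
have [t_gt0 t_le1] : 0 < a / (a + `|b|) /\ a / (a + `|b|) <= 1.
  by rewrite divr_gt0// ler_pdivrMr// mul1r lerDl.
have := quad _ t_gt0 t_le1; set t := a / _ in t_gt0 t_le1 *.
have tc : t * (a + `|b|) = a by rewrite /t divfK// gt_eqF.
have := ler_norm b; nra.
Qed.

Lemma continuous_sum (T : topologicalType) n (f : 'I_n -> T -> R) :
  (forall i, continuous (f i)) -> continuous (fun t => \sum_(i < n) f i t).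
Proof.
by move=> cf; apply: continuous_big => [|i _]; [exact: add_continuous|exact: cf].
Qed.

Lemma continuous_dot (T : topologicalType) n (f g : T -> 'cV[R]_n) :
  (forall i, continuous (fun t => f t i 0)) ->
  (forall i, continuous (fun t => g t i 0)) ->
  continuous (fun t => dot (f t) (g t)).
Proof.
by move=> cf cg; apply: continuous_sum => i t; apply: cvgM; [exact: cf|exact: cg].
Qed.

Lemma continuous_enorm (T : topologicalType) n (f : T -> 'cV[R]_n) :
  (forall i, continuous (fun t => f t i 0)) -> continuous (fun t => enorm (f t)).
Proof.
move=> cf; under eq_fun do rewrite enormE.
by move=> t; apply: continuous_comp; [exact: continuous_dot|exact: sqrt_continuous].
Qed.

Lemma convex_set_segment n (X : set 'cV[R]_n) u v t :
  convex_set X -> X u -> X v -> 0 <= t -> t <= 1 -> X (u + t *: (v - u)).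
Proof.
move=> vX Xu Xv t_ge0 t_le1.
have := vX v u (Itv01 t_ge0 t_le1) (mem_set Xv) (mem_set Xu).
rewrite inE; congr X.
rewrite /conv/= /unstable.onem; apply/matrixP => i j; rewrite !mxE; ring.
Qed.

(** Comparing the minimizer p with the points p + t (z - p) of X for small t
    gives <y - p, z - p> <= 0, from which |p - z| <= |y - z|. *)
Lemma proj_spec n (X : set 'cV[R]_n) (y z : 'cV[R]_n) :
  compact X -> convex_set X -> X z ->
  X (Defs.proj X y) /\ enorm (Defs.proj X y - z) <= enorm (y - z).
Proof.
move=> cX vX Xz.
have dist_cont : continuous (fun w : 'cV[R]_n => enorm (y - w)).
  apply: continuous_enorm => i; under eq_fun do rewrite !mxE.
  move=> w; exact: (@cvgB _ _ _ _ _ (fun=> y i 0) _ _ _ (cvg_cst _)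
    (@coord_continuous _ _ _ i 0 w)).
have [Xp p_min] : [set p | X p /\
    forall w, X w -> enorm (y - p) <= enorm (y - w)] (Defs.proj X y).
  have [||p Xp p_min] := @compact_EVT_min 'cV[R]_n R
      (fun w : 'cV[R]_n => enorm (y - w)) X _ cX.
  - by exists z.
  - by apply: continuous_subspaceT; exact: dist_cont.
  - exact: (@getI _ [set p | X p /\ forall w, X w -> enorm (y - p) <= enorm (y - w)]
      p (conj (set_mem Xp) (fun w Xw => p_min w (mem_set Xw)))).
set p := Defs.proj X y in Xp p_min *; split => //.
have obtuse : dot (y - p) (z - p) <= 0.
  apply: (@first_order_le0 _ (dot (z - p) (z - p))) => t t_gt0 t_le1.
  have := p_min _ (convex_set_segment vX Xp Xz (ltW t_gt0) t_le1).
  rewrite opprD addrA le_enorm -/p.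
  move: (y - p) (z - p) => a b; rewrite !dot_linear (dotC b a); nra.
rewrite le_enorm -[y - z](subrKA p) -(opprB z p) -/p.
move: (y - p) (z - p) obtuse => a b obtuse; rewrite !dot_linear (dotC b a).
by have := dot_ge0 a; lra.
Qed.

End EuclideanSpace.

(** * Extreme eigenvalues of symmetric matrices *)

Section Rayleigh.
Context {R : realType}.

Lemma unit_sphere_compact n :
  compact [set v : 'rV[R]_n | dot v^T v^T = 1].
Proof.
have cube : compact [set v : 'rV[R]_n | forall i, v ord0 i \in `[-1, 1]].
  by apply: (@rV_compact R n (fun=> `[(-1 : R), 1]%classic)) => _;
     exact: segment_compact.
apply: subclosed_compact cube _ => [|v /= v1 i].
  apply: (@closed_comp _ _ (fun v : 'rV[R]_n => dot v^T v^T) [set 1]).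
    by move=> v _; apply: continuous_dot => i; under eq_fun do rewrite mxE;
       exact: coord_continuous.
  exact: closed_eq.
have : v ord0 i ^+ 2 <= 1.
  rewrite -v1 /dot (bigD1 i)//= !mxE -expr2 lerDl.
  by apply: sumr_ge0 => j _; rewrite -expr2 sqr_ge0.
by rewrite in_itv/= => v2; apply/andP; split; nra.
Qed.

(** The quadratic form of A attains its maximum mu over the unit sphere at
    some u.  The form of mu - A is then nonnegative and vanishes at u, so its
    first variation at u, which is (mu - A) u, vanishes.  The vector v serves to
    make the sphere nonempty. *)
Lemma sym_quadratic_form_le n (A : 'M[R]_n) (v : 'cV[R]_n) :
  A^T = A -> v != 0 ->
  exists2 mu, eigenvalue A mu & forall w, dot w (A *m w) <= mu * dot w w.
Proof.
move=> A_sym v_neq0.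
have norm_gt0 (w : 'cV[R]_n) : w != 0 -> 0 < dot w w.
  move=> w0; rewrite lt_def dot_ge0 andbT.
  by apply: contra w0 => /eqP/dot_eq0 ->.
pose unit (w : 'cV[R]_n) := (Num.sqrt (dot w w))^-1 *: w.
have dot_unit w : w != 0 -> dot (unit w) (unit w) = 1.
  move=> w0; rewrite !dot_linear mulrA -expr2 exprVn sqr_sqrtr ?dot_ge0//.
  by rewrite mulVf// gt_eqF// norm_gt0.
have coordT i : continuous (fun w : 'rV[R]_n => w^T i 0).
  by under eq_fun do rewrite mxE; exact: coord_continuous.
have [||c c1 c_max] := @compact_EVT_max 'rV[R]_n R
    (fun w : 'rV[R]_n => dot w^T (A *m w^T)) _ _ (@unit_sphere_compact n).
- by exists (unit v)^T; rewrite /= trmxK dot_unit.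
- apply: continuous_subspaceT; apply: continuous_dot => // i.
  under eq_fun do rewrite mxE; apply: continuous_sum => j w.
  exact: (@cvgM _ _ _ _ (fun=> A i j) _ _ _ (cvg_cst _) (@coordT j w)).
set u := c^T in c_max; have {c1} u1 : dot u u = 1 by rewrite inE in c1.
set mu := dot u (A *m u) in c_max.
have mu_max w : dot w (A *m w) <= mu * dot w w.
  have [->|w0] := eqVneq w 0; first by rewrite mulmx0 !dotE mulmx0 mxE mulr0.
  have := c_max (unit w)^T; rewrite inE/= trmxK dot_unit// => /(_ erefl).
  rewrite -scalemxAr !dot_linear mulrA -expr2 exprVn sqr_sqrtr ?dot_ge0//.
  by rewrite mulrC ler_pdivrMr// norm_gt0.
exists mu => //; apply/eigenvalueP; exists u^T; last first.
  apply: contra_neq (oner_neq0 R) => uT0.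
  by rewrite -u1 dotE uT0 mul0mx mxE.
rewrite -[LHS]trmxK trmx_mul trmxK A_sym -[RHS]trmxK linearZ/= trmxK; congr (_^T).
apply/eqP; rewrite -subr_eq0; apply/eqP/dot_eq0/eqP.
(* d is opaque, lest the linearity rules of dot unfold it. *)
have [d dE] : exists d, d = A *m u - mu *: u by eexists.
rewrite -dE eq_le dot_ge0 andbT.
apply: (@first_order_le0 _ _ (mu * dot d d - dot d (A *m d))) => t _ _.
have Aud : dot u (A *m d) = dot d (A *m u) by rewrite dotC dot_mulmx A_sym.
have dd : dot d d = dot d (A *m u) - mu * dot u d.
  by rewrite {2}dE !dot_linear (dotC u).
have := mu_max (u + t *: d).
by rewrite mulmxDr -scalemxAr !dot_linear u1 -/mu Aud (dotC d u); nra.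
Qed.

(** Testing the bound mu of the previous lemma on eigenvectors shows that mu
    bounds all eigenvalues, so that the supremum defining lambda_max is a
    genuine one and is at least mu. *)
Lemma le_lambda_max n (A : 'M[R]_n) w :
  A^T = A -> dot w (A *m w) <= lambda_max A * dot w w.
Proof.
move=> A_sym; have [->|w0] := eqVneq w 0.
  by rewrite mulmx0 !dotE mulmx0 mxE mulr0.
have [mu mu_eig mu_max] := sym_quadratic_form_le A_sym w0.
apply: le_trans (mu_max w) _; rewrite ler_wpM2r ?dot_ge0//.
apply: sup_upper_bound => //; split; first by exists mu.
exists mu => a /eigenvalueP[v vA v0].
have := mu_max v^T; rewrite -[in A *m _]A_sym -trmx_mul vA linearZ/= dotZr.
rewrite ler_pM2r// lt_def dot_ge0 andbT.
by apply: contra v0 => /eqP/dot_eq0 vT0; rewrite -[v]trmxK vT0 trmx0.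
Qed.

Lemma eigenvalueN n (A : 'M[R]_n) a : eigenvalue (- A) a = eigenvalue A (- a).
Proof.
apply/eigenvalueP/eigenvalueP => -[v vA v0]; exists v => //.
  by rewrite scaleNr -vA mulmxN opprK.
by rewrite mulmxN vA scaleNr opprK.
Qed.

Lemma lambda_maxN n (A : 'M[R]_n) : lambda_max (- A) = - lambda_min A.
Proof.
rewrite /lambda_min /inf opprK; congr sup; apply/seteqP; split=> a /=.
  by rewrite eigenvalueN => aA; exists (- a); rewrite ?opprK.
by case=> b bA <-; rewrite eigenvalueN opprK.
Qed.

Lemma ge_lambda_min n (A : 'M[R]_n) w :
  A^T = A -> lambda_min A * dot w w <= dot w (A *m w).
Proof.
move=> A_sym; have : (- A)^T = - A by rewrite linearN /= A_sym.
by move/(@le_lambda_max _ _ w); rewrite lambda_maxN mulNmx dotNr mulNr lerN2.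
Qed.

Lemma gram_sym m n (A : 'M[R]_(m, n)) : (A^T *m A)^T = A^T *m A.
Proof. by rewrite trmx_mul trmxK. Qed.

Lemma dot_gram m n (A : 'M[R]_(m, n)) u v :
  dot u (A^T *m A *m v) = dot (A *m u) (A *m v).
Proof. by rewrite dot_mulmx mulmxA. Qed.

Lemma enorm_mulmx_le m n (A : 'M[R]_(m, n)) v :
  enorm (A *m v) <= spectral_norm A * enorm v.
Proof.
rewrite /spectral_norm !enormE mulrC -sqrtrM ?dot_ge0// ler_wsqrtr// mulrC.
by rewrite -dot_gram; exact/le_lambda_max/gram_sym.
Qed.

Lemma enorm_mulmx_ge m n (A : 'M[R]_(m, n)) v :
  Num.sqrt (lambda_min (A^T *m A)) * enorm v <= enorm (A *m v).
Proof.
rewrite !enormE mulrC -sqrtrM ?dot_ge0// ler_wsqrtr// mulrC.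
by rewrite -dot_gram; exact/ge_lambda_min/gram_sym.
Qed.

(** |A^T v|^2 = <A (A^T v), v> <= |A (A^T v)| |v|, so the bound for A
    carries over to its transpose. *)
Lemma enorm_trmx_mulmx_le m n (A : 'M[R]_(m, n)) v :
  enorm (A^T *m v) <= spectral_norm A * enorm v.
Proof.
apply: mul_le_cancel; rewrite ?mulr_ge0 ?enorm_ge0 ?sqrtr_ge0//.
rewrite sqr_enorm -dot_mulmx (le_trans (dot_le _ _))// mulrA.
by rewrite ler_wpM2r ?enorm_ge0// mulrC enorm_mulmx_le.
Qed.

End Rayleigh.

(** * Quadratic Taylor remainder *)

Section Taylor.
Context {R : realType} {N M : nat}.
Variable g : 'cV[R]_N -> 'cV[R]_M.

Lemma differentiable_coord_fun x i :
  differentiable g x -> differentiable (fun y => g y i 0) x.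
Proof.
move=> dg; apply: (@differentiable_comp _ _ _ _ g (fun v : 'cV[R]_M => v i 0)) => //.
exact: differentiable_coord.
Qed.

Lemma Jac_mulmxE x h i : differentiable g x ->
  (Jac g x *m h) i 0 = 'D_h (fun y => g y i 0) x.
Proof.
move=> /(differentiable_coord_fun i) dgi; rewrite deriveE// mxE.
rewrite {2}(matrix_sum_delta h) linear_sum; apply: eq_bigr => j _.
by rewrite big_ord1 linearZ/= !mxE deriveE// mulrC.
Qed.

Lemma is_derive_line (f : 'cV[R]_N -> R) x h t : differentiable f (x + t *: h) ->
  is_derive t 1 (fun s => f (x + s *: h)) ('D_h f (x + t *: h)).
Proof.
move=> df.
have dl : is_diff t (fun s : R => x + s *: h) (fun s => s *: h).
  rewrite (_ : (fun s => s *: h) = cst 0 + (fun s => s *: h)); last first.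
    by apply/funext => s; rewrite /cst/= add0r.
  exact: is_diffD.
have dfl : differentiable (f \o (fun s : R => x + s *: h)) t.
  by apply: differentiable_comp.
apply: DeriveDef; first exact: diff_derivable.
rewrite deriveE// diff_comp//= diff_val scale1r.
by rewrite deriveE.
Qed.

Lemma is_derive_dot_line r x h t : differentiable g (x + t *: h) ->
  is_derive t 1 (fun s => dot r (g (x + s *: h))) (dot r (Jac g (x + t *: h) *m h)).
Proof.
move=> dg; rewrite /dot.
under eq_bigr do rewrite Jac_mulmxE//.
rewrite (_ : (fun s => _) = \sum_(i < M) (fun s => r i 0 * g (x + s *: h) i 0)).
  apply: is_derive_sum => i.
  apply: (@is_deriveZ _ _ _ (fun s : R => g (x + s *: h) i 0)).
  exact/is_derive_line/differentiable_coord_fun.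
by apply/funext => s; rewrite fct_sumE.
Qed.

(** Let r be the remainder.  Testing it against itself gives |r|^2 as the
    increment over [0, 1] of the real function
      <r, g (x + s h)> - s <r, G(x) h>,
    whose derivative <r, (G(x + s h) - G(x)) h> is at most |r| omega s |h|^2.
    Subtracting s^2 |r| omega |h|^2 / 2 therefore yields a nonincreasing
    function phi, and phi 1 <= phi 0 is the claim multiplied by |r|.  Only the
    points of the segment are used, so a Lipschitz bound on X suffices. *)
Lemma Jac_remainder_le (X : set 'cV[R]_N) (omega : R) x h :
  0 <= omega -> convex_set X -> (forall z, differentiable g z) ->
  (forall z z', X z -> X z' ->
     spectral_norm (Jac g z - Jac g z') <= omega * enorm (z - z')) ->
  X x -> X (x + h) ->
  enorm (g (x + h) - g x - Jac g x *m h) <= omega / 2 * enorm h ^+ 2.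
Proof.
move=> omega_ge0 vX dg lip Xx Xh.
have [r rE] : exists r, r = g (x + h) - g x - Jac g x *m h by eexists.
pose a := dot r (Jac g x *m h).
pose b := enorm r * (omega / 2 * enorm h ^+ 2).
pose phi : R -> R := (fun s => dot r (g (x + s *: h))) - (a *: id + b *: (id ^+ 2)).
have dphi (t : R) : is_derive t (1 : R) phi
    (dot r (Jac g (x + t *: h) *m h) - (a + 2 * t * b)).
  apply: is_deriveB; first exact: is_derive_dot_line.
  apply: is_derive_eq.
  by rewrite /= /GRing.scale/=; ring.
have dphi_le0 t : t \in `]0, 1[%R -> derive1 phi t <= 0.
  rewrite in_itv/= => /andP[t_gt0 t_lt1]; rewrite derive1E derive_val.
  rewrite opprD addrA subr_le0 /a -dotNr -dotDr -mulmxBl.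
  apply: le_trans (dot_le _ _) _.
  rewrite /b mulrCA ler_wpM2l ?enorm_ge0//.
  apply: le_trans (enorm_mulmx_le _ _) _.
  have Xt : X (x + t *: h).
    by have := convex_set_segment vX Xx Xh (ltW t_gt0) (ltW t_lt1);
       rewrite [x + h]addrC addrK.
  have := lip _ _ Xt Xx; rewrite [x + _]addrC addrK enormZ gtr0_norm// => lip_t.
  apply: le_trans (ler_wpM2r (enorm_ge0 _) lip_t) _.
  by rewrite le_eqVlt; apply/orP; left; apply/eqP; field.
have phi_le : phi 1 <= phi 0.
  apply: (@ler0_derive1_le_cc _ phi 0 1) => //; rewrite ?in_itv/= ?lexx ?ler01//.
  by apply: derivable_within_continuous => t _.
rewrite -rE; apply: mul_le_cancel; rewrite ?enorm_ge0//.
  by rewrite mulr_ge0 ?divr_ge0 ?sqr_ge0.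
rewrite -/b sqr_enorm [X in dot r X]rE.
move: phi_le; rewrite /phi !fctE scale1r scale0r addr0 /GRing.scale/=.
by rewrite !dot_linear -/a; lra.
Qed.

End Taylor.

(** * Least-squares inverse *)

Section Gram.
Context {R : realType} {m n : nat}.
Variables (A : 'M[R]_(m, n)) (s : R).
Hypotheses (s_gt0 : 0 < s) (A_ge : forall v, s * enorm v <= enorm (A *m v)).

Lemma gram_unitmx : A^T *m A \in unitmx.
Proof.
rewrite -row_free_unit -kermx_eq0; apply/rowV0P => v /sub_kermxP vG.
have Av0 : A *m v^T = 0.
  apply: dot_eq0; rewrite -dot_gram dotE trmxK mulmxA.
  by rewrite vG mul0mx mxE.
have := A_ge v^T; rewrite Av0 enorm0 pmulr_rle0// => v_le0.
have /enorm_eq0 vT0 : enorm v^T = 0 by apply/eqP; rewrite eq_le v_le0 enorm_ge0.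
by rewrite -[v]trmxK vT0 trmx0.
Qed.

(** With w = (A^T A)^-1 A^T b, one has |A w|^2 = <A w, b>, hence |A w| <= |b|. *)
Lemma enorm_pinv_le b : s * enorm (invmx (A^T *m A) *m (A^T *m b)) <= enorm b.
Proof.
set w := invmx _ *m _; apply: le_trans (A_ge w) _.
apply: mul_le_cancel; rewrite ?enorm_ge0// sqr_enorm -dot_gram.
by rewrite /w mulKVmx ?gram_unitmx// -dot_mulmx dot_le.
Qed.

(** With w = (A^T A)^-1 c, one has s^2 |w|^2 <= |A w|^2 = <w, c> <= |w| |c|. *)
Lemma enorm_gram_inv_le c : s ^+ 2 * enorm (invmx (A^T *m A) *m c) <= enorm c.
Proof.
set w := invmx _ *m _.
have Aw2 : enorm (A *m w) ^+ 2 <= enorm w * enorm c.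
  by rewrite sqr_enorm -dot_gram /w mulKVmx ?gram_unitmx// dot_le.
have [->|w_neq0] := eqVneq (enorm w) 0; first by rewrite mulr0 enorm_ge0.
have w_gt0 : 0 < enorm w by rewrite lt_def w_neq0 enorm_ge0.
rewrite -(ler_pM2l w_gt0); apply: le_trans Aw2.
rewrite (_ : enorm w * (s ^+ 2 * _) = (s * enorm w) ^+ 2); last by ring.
by rewrite lerXn2r ?nnegrE ?mulr_ge0 ?enorm_ge0// ltW.
Qed.

End Gram.

(** * Error of an exact Gauss-Newton step *)

Section GaussNewtonStep.
Context {R : realType} {N M : nat}.
Variables (g : 'cV[R]_N -> 'cV[R]_M) (X : set 'cV[R]_N) (sigma omega : R).
Hypotheses (vX : convex_set X) (dg : forall z, differentiable g z).
Hypotheses (sigma_gt0 : 0 < sigma) (omega_ge0 : 0 <= omega).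
Hypothesis G_ge : forall z v, X z -> sigma * enorm v <= enorm (Jac g z *m v).
Hypothesis G_lip : forall z z', X z -> X z' ->
  spectral_norm (Jac g z - Jac g z') <= omega * enorm (z - z').

(** Let G and Gs be the Jacobians at x and xs, and G^+ = (G^T G)^-1 G^T.  Since
    G^+ G = 1, the error left by a full Gauss-Newton step is
      G^+ (g xs - g x - G (xs - x)) - G^+ (g xs).
    The first term is quadratic in x - xs by the remainder bound.  As
    Gs^T g(xs) = 0, the second one equals (G^T G)^-1 (G - Gs)^T g(xs), which is
    linear in x - xs by the Lipschitz bound on the Jacobian. *)
Lemma gauss_newton_error_le x xs : X x -> X xs -> (Jac g xs)^T *m g xs = 0 ->
  enorm (x - xs - invmx ((Jac g x)^T *m Jac g x) *m ((Jac g x)^T *m g x)) <=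
  omega / (2 * sigma) * enorm (x - xs) ^+ 2
  + omega * enorm (g xs) / sigma ^+ 2 * enorm (x - xs).
Proof.
move=> Xx Xs xs_fix; set G := Jac g x.
have [e eE] : exists e, e = x - xs by eexists.
have Gx_ge v : sigma * enorm v <= enorm (G *m v) by exact: G_ge.
have Gunit := gram_unitmx sigma_gt0 Gx_ge.
have x_e : x - e = xs by rewrite eE opprB addrC subrK.
have := @Jac_remainder_le _ _ _ g X omega x (- e) omega_ge0 vX dg G_lip Xx.
rewrite x_e -/G -eE enormN => /(_ Xs); set r := _ - _ - _ => r_le.
have -> : e - invmx (G^T *m G) *m (G^T *m g x) =
    invmx (G^T *m G) *m (G^T *m r)
    - invmx (G^T *m G) *m ((G - Jac g xs)^T *m g xs).
  rewrite [(G - _)^T]linearB/= mulmxBl xs_fix subr0 /r mulmxN opprK.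
  rewrite !mulmxDr !mulmxN (mulmxA G^T G e) mulKmx//.
  by rewrite [RHS]addrC !addrA addNr add0r addrC.
apply: le_trans (enormD _ _) _; rewrite enormN; apply: lerD.
  have := enorm_pinv_le sigma_gt0 Gx_ge r; move=> /le_trans/(_ r_le).
  rewrite -ler_pdivlMl// => /le_trans; apply.
  by rewrite le_eqVlt; apply/orP; left; apply/eqP; field; rewrite ?gt_eqF//.
have := enorm_gram_inv_le sigma_gt0 Gx_ge ((G - Jac g xs)^T *m g xs).
have le2 := le_trans (enorm_trmx_mulmx_le (G - Jac g xs) (g xs))
  (ler_wpM2r (enorm_ge0 (g xs)) (G_lip Xx Xs)).
move=> /le_trans/(_ le2); rewrite -ler_pdivlMl ?exprn_gt0// => /le_trans; apply.
by rewrite le_eqVlt; apply/orP; left; apply/eqP; rewrite -eE; field;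
   rewrite ?gt_eqF//.
Qed.

End GaussNewtonStep.

(** * Limsup of a quadratic recursion *)

Section QuadraticRecursion.
Context {R : realType}.

(** The majorant a + q ^+ k * C is nonincreasing, so it also bounds the suprema
    of the tails, whose limit is the limsup. *)
Lemma geometric_limn_esup_le (e : nat -> R) (a C q : R) :
  0 <= q -> q < 1 -> 0 <= C -> (forall k, e k <= a + q ^+ k * C) ->
  (limn_esup (fun k => (e k)%:E) <= a%:E)%E.
Proof.
move=> q_ge0 q_lt1 C_ge0 e_le.
have b_cvg : (fun k => (a + q ^+ k * C)%:E) @ \oo --> a%:E.
  apply: cvg_EFin; first exact: nearW.
  have : (fun k => a + q ^+ k * C) @ \oo --> a + 0 * C.
    apply: cvgD; first exact: cvg_cst.
    by apply: cvgMl; apply: cvg_expr; rewrite ger0_norm.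
  by rewrite mul0r addr0.
rewrite limn_esup_lim -(cvg_lim _ b_cvg)//.
apply: lee_lim; [exact: is_cvg_esups|by apply/cvg_ex; exists a%:E|].
apply: nearW => k; apply: ge_ereal_sup => _ [l /= kl <-].
rewrite lee_fin (le_trans (e_le l))// lerD2l ler_wpM2r//.
by rewrite ler_wiXn2l// ltW.
Qed.

(** If a < b are the fixed points of f t = T1 t^2 + T2 t + c, then
    f t - a = (t - a) (T1 (t + a) + T2), and the slope T1 (t + a) + T2 stays
    below T1 (b + a) + T2 = 1 when t stays away from b: starting below b, the
    excess over a decreases geometrically. *)
Lemma quadratic_recursion_limn_esup_le (T1 T2 c a b : R) (e : nat -> R) :
  0 < T1 -> 0 <= T2 -> 0 <= a -> a < b ->
  T1 * (a + b) + T2 = 1 -> T1 * a ^+ 2 + T2 * a + c = a ->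
  (forall k, 0 <= e k) -> (forall k, e k.+1 <= T1 * e k ^+ 2 + T2 * e k + c) ->
  e 0%N < b ->
  (limn_esup (fun k => (e k.+1)%:E) <= a%:E)%E.
Proof.
move=> T1_gt0 T2_ge0 a_ge0 ab sum1 fix_a e_ge0 e_rec e0b.
(* The maximum covers a start below a, where a itself is the majorant. *)
pose r := Num.max (e 0%N) a; pose q := T1 * (r + a) + T2.
have ar : a <= r by rewrite le_max lexx orbT.
have rb : r < b by rewrite gt_max e0b.
have q_ge0 : 0 <= q by rewrite /q; nra.
have q_lt1 : q < 1 by rewrite /q; nra.
have e_le k : e k <= a + q ^+ k * (r - a).
  elim: k => [|k IHk]; first by rewrite expr0 mul1r addrC subrK le_max lexx.
  apply: le_trans (e_rec k) _.
  have [d_ge0 d_le] : 0 <= q ^+ k * (r - a) /\ q ^+ k * (r - a) <= r - a.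
    rewrite mulr_ge0 ?exprn_ge0 ?subr_ge0//; split=> //.
    by rewrite ler_piMl ?subr_ge0// exprn_ile1// ltW.
  rewrite (exprS q) -mulrA.
  move: (q ^+ k * (r - a)) d_ge0 d_le IHk => d d_ge0 d_le IHk.
  apply: (@le_trans _ _ (T1 * (a + d) ^+ 2 + T2 * (a + d) + c)).
    rewrite lerD2r lerD// ler_wpM2l ?(ltW T1_gt0)//.
    by rewrite lerXn2r ?nnegrE// addr_ge0.
  have -> : T1 * (a + d) ^+ 2 + T2 * (a + d) + c =
      T1 * a ^+ 2 + T2 * a + c + (T1 * (a + d + a) + T2) * d by ring.
  rewrite fix_a.
  rewrite lerD2l ler_wpM2r// /q lerD2r ler_wpM2l ?(ltW T1_gt0)//; lra.
apply: (@geometric_limn_esup_le _ a (q * (r - a)) q) => //.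
  by rewrite mulr_ge0 ?subr_ge0.
by move=> k; rewrite mulrA -exprSr.
Qed.

End QuadraticRecursion.

(** * Convergence of the gossip-based iterates *)

Theorem theorem1 (R : realType) (N I : nat) (M : 'I_I -> nat)
  (X : set 'cV[R]_N) (g : 'cV[R]_N -> 'cV[R]_(\sum_(i < I) M i))
  (eps_max sigma_min sigma_max omega : R)
  (X_compact : compact X) (X_convex : convex_set X)
  (g_C1 : continuously_differentiable g)
  (g_bound : forall x, X x -> enorm (g x) <= eps_max)
  (G_full_column_rank : forall x, X x -> \rank (Jac g x) = N)
  (sigma_minE : is_minimum
     [set Num.sqrt (lambda_min ((Jac g x)^T *m Jac g x)) | x in X] sigma_min)
  (sigma_maxE : is_maximum
     [set Num.sqrt (lambda_max ((Jac g x)^T *m Jac g x)) | x in X] sigma_max)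
  (sigma_min_gt0 : 0 < sigma_min) (sigma_min_le_max : sigma_min <= sigma_max)
  (omega_gt0 : 0 < omega)
  (G_lipschitz : forall x x', X x -> X x' ->
     spectral_norm (Jac g x - Jac g x') <= omega * enorm (x - x'))
  (xstar : 'cV[R]_N) (xstar_in : X xstar)
  (xstar_fixed : (Jac g xstar)^T *m g xstar = 0)
  (alpha : R)
  (alpha_gt : Num.max (1 - 3 * sigma_min / sigma_max) 0 < alpha)
  (alpha_le1 : alpha <= 1)
  (kappa : R) (ell : nat -> nat) (W : nat -> nat -> 'M[R]_I)
  (x : nat -> 'I_I -> 'cV[R]_N) (x_GGN : GGN_iterates g X alpha ell W x) :
  let eps_min := enorm (g xstar) in
  let T1 := alpha * omega / (2 * sigma_min) in
  let T2 := (1 - alpha) * (sigma_max / sigma_min)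
            + Num.sqrt 2 * alpha * omega * eps_min / sigma_min ^+ 2 in
  let disc := (1 - T2) ^+ 2 - 4 * alpha * T1 * kappa in
  let rho_min := (1 - T2 - Num.sqrt disc) / (2 * T1) in
  let rho_max := (1 - T2 + Num.sqrt disc) / (2 * T1) in
  omega * eps_min < sigma_min ^+ 2 / (Num.sqrt 2 * alpha)
                    * (3 - (1 - alpha) * (sigma_max / sigma_min)) ->
  0 < kappa -> kappa < (1 - T2) ^+ 2 / (4 * alpha * T1) ->
  (forall k i, enorm (gossip_descent g (W k) (ell k) (x k) i
                      - exact_descent g (x k i)) <= kappa) ->
  (forall i, enorm (x 0%N i - xstar) < rho_max) ->
  forall i, (limn_esup (fun k => (enorm (x k.+1 i - xstar))%:E)
             <= rho_min%:E)%E.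
Proof.
move=> eps_min T1 T2 disc rho_min rho_max _ kappa_gt0 kappa_lt descent_err x0_lt i.
have alpha_gt0 : 0 < alpha by apply: le_lt_trans alpha_gt; rewrite le_max lexx orbT.
have [x0_in _ x_step] := x_GGN.
have [_ sigma_min_lb] := sigma_minE.
have [dg _] := g_C1.
have G_ge z v : X z -> sigma_min * enorm v <= enorm (Jac g z *m v).
  move=> Xz; apply: le_trans (enorm_mulmx_ge _ _).
  by rewrite ler_wpM2r ?enorm_ge0// sigma_min_lb//; exists z.
have x_in k j : X (x k j).
  elim: k => // k _; rewrite x_step.
  by have [] := proj_spec (x k j - alpha *: gossip_descent g (W k) (ell k) (x k) j)
                  X_compact X_convex xstar_in.
pose e k := enorm (x k i - xstar).
have e_ge0 k : 0 <= e k by exact: enorm_ge0.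
have eps_ge0 : 0 <= eps_min by exact: enorm_ge0.
have T1_gt0 : 0 < T1 by rewrite divr_gt0 ?mulr_gt0.
have sigma_ratio : 1 <= sigma_max / sigma_min by rewrite ler_pdivlMr// mul1r.
have T2_ge0 : 0 <= T2.
  rewrite addr_ge0 ?mulr_ge0 ?invr_ge0 ?exprn_ge0 ?sqrtr_ge0 ?subr_ge0// ltW//.
  by rewrite (lt_le_trans sigma_min_gt0).
(* The error of the damped perturbed step is (1 - alpha) times the old error,
   plus alpha times the error of the full exact step, minus alpha times the
   error d - d0 on the descent; the projection does not increase it. *)
have e_rec k : e k.+1 <= T1 * e k ^+ 2 + T2 * e k + alpha * kappa.
  rewrite /e x_step; set d := gossip_descent _ _ _ _ _.
  have [_ /le_trans->//] := proj_spec (x k i - alpha *: d)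
    X_compact X_convex xstar_in.
  pose d0 := exact_descent g (x k i).
  have -> : x k i - alpha *: d - xstar =
      (1 - alpha) *: (x k i - xstar) + alpha *: (x k i - xstar - d0)
      - alpha *: (d - d0).
    by apply/matrixP => a b; rewrite !mxE; ring.
  apply: le_trans (enormD _ _) _; rewrite enormN enormZ gtr0_norm//.
  apply: lerD; last by rewrite ler_wpM2l ?(ltW alpha_gt0)// descent_err.
  apply: le_trans (enormD _ _) _; rewrite !enormZ (gtr0_norm alpha_gt0).
  rewrite ger0_norm ?subr_ge0// -/(e k).
  have := gauss_newton_error_le X_convex dg sigma_min_gt0 (ltW omega_gt0) G_ge
    G_lipschitz (x_in k i) xstar_in xstar_fixed.
  rewrite -/(exact_descent g (x k i)) -/d0 -/(e k) -/eps_min => step.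
  apply: le_trans (lerD (lexx _) (ler_wpM2l (ltW alpha_gt0) step)) _.
  (* T2 majorizes the linear coefficient found so far: its two terms carry the
     extra factors sigma_max / sigma_min and sqrt 2, both at least 1. *)
  have sqrt2_ge1 : 1 <= Num.sqrt 2 :> R.
    by rewrite -[leLHS]sqrtr1 ler_wsqrtr// ler1n.
  have q_ge0 : 0 <= alpha * omega * eps_min / sigma_min ^+ 2 * e k.
    by rewrite !mulr_ge0 ?invr_ge0 ?exprn_ge0// ltW.
  have -> : T1 * e k ^+ 2 + T2 * e k =
      alpha * (omega / (2 * sigma_min) * e k ^+ 2)
      + (sigma_max / sigma_min) * ((1 - alpha) * e k)
      + Num.sqrt 2 * (alpha * omega * eps_min / sigma_min ^+ 2 * e k).
    by rewrite /T1 /T2; field; rewrite gt_eqF.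
  have p_ge0 : 0 <= (1 - alpha) * e k by rewrite mulr_ge0 ?subr_ge0.
  have -> : alpha * (omega / (2 * sigma_min) * e k ^+ 2
        + omega * eps_min / sigma_min ^+ 2 * e k) =
      alpha * (omega / (2 * sigma_min) * e k ^+ 2)
      + alpha * omega * eps_min / sigma_min ^+ 2 * e k.
    by field; rewrite gt_eqF.
  by have := ler_peMl q_ge0 sqrt2_ge1; have := ler_peMl p_ge0 sigma_ratio; lra.
have disc_gt0 : 0 < disc.
  by rewrite subr_gt0 (mulrC _ kappa) -ltr_pdivlMr// mulr_gt0// mulr_gt0.
have s_gt0 : 0 < Num.sqrt disc by rewrite sqrtr_gt0.
have s_sqr : Num.sqrt disc ^+ 2 = disc by rewrite sqr_sqrtr// ltW.
have c_gt0 : 0 < 4 * alpha * T1 * kappa by rewrite mulr_gt0// mulr_gt0// mulr_gt0.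
have s_lt : Num.sqrt disc < `|1 - T2|.
  have disc_lt : disc < (1 - T2) ^+ 2 by rewrite ltrBlDr ltrDl.
  by rewrite -sqrtr_sqr ltr_sqrt// (lt_trans disc_gt0).
have T1x2_gt0 : 0 < 2 * T1 by rewrite mulr_gt0.
have rho_max_gt0 : 0 < rho_max by exact: le_lt_trans (enorm_ge0 _) (x0_lt i).
(* As sqrt disc < |1 - T2|, the number rho_max has the sign of 1 - T2; it is
   positive because it exceeds a norm. *)
have T2_lt1 : 0 < 1 - T2.
  move: rho_max_gt0; rewrite pmulr_lgt0 ?invr_gt0//.
  by case: (ltrP 0 (1 - T2)) s_lt => // T2_ge1; rewrite ler0_norm//; lra.
rewrite gtr0_norm// in s_lt.
have rho_min_ge0 : 0 <= rho_min by rewrite divr_ge0 ?(ltW T1x2_gt0)// subr_ge0 ltW.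
have rho_lt : rho_min < rho_max.
  by rewrite ltr_pM2r ?invr_gt0// ltrD2l; lra.
have rho_sum : T1 * (rho_min + rho_max) + T2 = 1.
  by rewrite /rho_min /rho_max; field; rewrite gt_eqF.
have rho_fix : T1 * rho_min ^+ 2 + T2 * rho_min + alpha * kappa = rho_min.
  have root_eq s : T1 * ((1 - T2 - s) / (2 * T1)) ^+ 2
      + T2 * ((1 - T2 - s) / (2 * T1)) + alpha * kappa =
      (1 - T2 - s) / (2 * T1)
      + (s ^+ 2 - ((1 - T2) ^+ 2 - 4 * alpha * T1 * kappa)) / (4 * T1).
    by field; rewrite gt_eqF.
  by rewrite /rho_min root_eq s_sqr subrr mul0r addr0.
exact: (quadratic_recursion_limn_esup_le T1_gt0 T2_ge0 rho_min_ge0 rho_lt rho_sum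
  rho_fix e_ge0 e_rec (x0_lt i)).
Qed.
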